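(* Let $G$ be a unicyclic graph on $n$ vertices (a connected graph containing exactly one cycle). (i) If the cycle of $G$ has $2k+1$ vertices, then $P_{DP}(G,m)=P(G,m)$ for every $m\in\mathbb{N}$. (ii) If the cycle of $G$ has $2k+2$ vertices, then for every integer $m\geq 2$, $$P_{DP}(G,m)=(m-1)^n-(m-1)^{n-2k-2}.$$
   Context: All graphs are finite and simple. $P(G,m)$ denotes the chromatic polynomial of $G$. A cover of a graph $G$ is a pair $\mathcal{H}=(L,H)$ where $H$ is a graph and $L:V(G)\to\mathcal{P}(V(H))$ satisfies: (1) the sets $L(u)$, $u\in V(G)$, partition $V(H)$; (2) for every $u$, $H[L(u)]$ is complete; (3) if $E_H(L(u),L(v))\neq\emptyset$ then $u=v$ or $uv\in E(G)$; (4) if $uv\in E(G)$ then $E_H(L(u),L(v))$ is a matching (possibly empty). Here $E_H(S,U)$ is the set of edges of $H$ between $S$ and $U$. The cover is $m$-fold if $|L(u)|=m$ for all $u$. An $\mathcal{H}$-coloring is an independent set of $H$ of size $|V(G)|$. $P_{DP}(G,\mathcal{H})$ is the number of $\mathcal{H}$-colorings, and $P_{DP}(G,m)$ is the minimum of $P_{DP}(G,\mathcal{H})$ over all $m$-fold covers $\mathcal{H}$ of $G$. *)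

(* Defs.v *)
From mathcomp Require Import all_boot.
Set Implicit Arguments. Unset Strict Implicit. Unset Printing Implicit Defensive.

Section Graphs.
Variable T : finType.
(* A simple graph G on the vertex set T is a relation e, assumed symmetric
   and irreflexive (these are hypotheses of the main theorem). *)
Variable e : rel T.

Definition chrom (m : nat) : nat :=
  #|[set f : {ffun T -> 'I_m} | [forall x, forall y, e x y ==> (f x != f y)]]|.

Definition gconnected : bool := [forall x, forall y, connect e x y].

Definition is_gcycle (c : seq T) : bool := [&& cycle e c, uniq c & 2 < size c].

(* The edge set of the cycle c (as unordered pairs); two cycles are the same
   subgraph iff they have the same edge set. *)
Definition cycle_edges (c : seq T) : {set {set T}} :=
  [set [set x; next c x] | x in c].

Definition unicyclic_with_cycle_len (l : nat) : Prop :=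
  gconnected /\
  exists c, [/\ is_gcycle c, size c = l &
    forall c', is_gcycle c' -> cycle_edges c' = cycle_edges c].

(* m-fold covers.  The vertex set of H is T * 'I_m, with L(u) = {u} x 'I_m;
   H is given by its (ordered-pair) edge set. *)
Definition hadj (m : nat) (H : {set (T * 'I_m) * (T * 'I_m)}) x y :=
  (x, y) \in H.

Definition is_cover (m : nat) (H : {set (T * 'I_m) * (T * 'I_m)}) : bool :=
  [&& [forall x, forall y, hadj H x y == hadj H y x],
      [forall x, ~~ hadj H x x],
      [forall x, forall y, ((x.1 == y.1) && (x.2 != y.2)) ==> hadj H x y],
      [forall x, forall y, ((x.1 != y.1) && hadj H x y) ==> e x.1 y.1]
    & [forall x, forall v : T, (v != x.1) ==>
         (#|[set j : 'I_m | hadj H x (v, j)]| <= 1)]].     (* E_H(L(u),L(v)) matching *)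

Definition h_independent (m : nat) (H : {set (T * 'I_m) * (T * 'I_m)})
  (S : {set T * 'I_m}) : bool :=
  [forall x in S, forall y in S, ~~ hadj H x y].

Definition PDP_cover (m : nat) (H : {set (T * 'I_m) * (T * 'I_m)}) : nat :=
  #|[set S : {set T * 'I_m} | h_independent H S && (#|S| == #|T|)]|.

Definition trivial_cover (m : nat) : {set (T * 'I_m) * (T * 'I_m)} :=
  [set p | (p.1.1 == p.2.1) && (p.1.2 != p.2.2)].

Lemma trivial_cover_ok m : is_cover (trivial_cover m).
Proof.
rewrite /is_cover /hadj /trivial_cover.
apply/and5P; split.
- apply/forallP => x; apply/forallP => y; rewrite !inE /=.
  by rewrite (eq_sym x.1) (eq_sym x.2).
- by apply/forallP => x; rewrite !inE /= !eqxx.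
- by apply/forallP => x; apply/forallP => y; rewrite !inE /=; apply/implyP.
- apply/forallP => x; apply/forallP => y; rewrite !inE /=.
  by case: (x.1 == y.1) => //=; rewrite andbF.
- apply/forallP => x; apply/forallP => v; apply/implyP => hv.
  suff -> : [set j : 'I_m | ((x, (v, j)) \in [set p | (p.1.1 == p.2.1) && (p.1.2 != p.2.2)])] = set0 by rewrite cards0.
  by apply/setP => j; rewrite !inE /= eq_sym (negbTE hv).
Qed.

Lemma PDP_exists m :
  exists n, [exists H, is_cover H && (@PDP_cover m H == n)].
Proof.
exists (PDP_cover (trivial_cover m)); apply/existsP; exists (trivial_cover m).
by rewrite trivial_cover_ok eqxx.
Qed.

Definition PDP (m : nat) : nat := ex_minn (PDP_exists m).

End Graphs.

(* Main.v *)
Require Import Defs.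
From mathcomp Require Import all_boot.
From mathcomp Require Import perm zify.
Set Implicit Arguments. Unset Strict Implicit. Unset Printing Implicit Defensive.

(* Every matching of a cover extends to a bijection pi x y of the colors, which
   only removes colorings, so it suffices to count the functions f with
   f y != pi x y (f x) on every edge.  Growing the cycle c to the whole graph
   vertex by vertex, each new vertex has exactly one earlier neighbor, hence
   m - 1 admissible colors.  On the cycle, a coloring starting with color a is a
   closed walk of length |c| in K_m up to the relabelling by the pi x y: what
   remains is to count the walks from a to its image under the holonomy of pi
   around c.  There are two cases, fixed and moved colors; the parity of |c|
   decides which contributes less.  The identity cover fixes all colors, while a
   cyclic shift on a single edge of c moves all of them. *)

(** * Functions supported on a vertex set *)

Section Supported.
Variables (T : finType) (M : nat).
Implicit Types (A : {set T}) (f g : {ffun T -> 'I_M.+1}).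

(* Colorings of the subgraph induced on A are encoded as functions on all of T
   that take the value ord0 outside A. *)
Definition supp A : {set {ffun T -> 'I_M.+1}} :=
  [set f : {ffun T -> 'I_M.+1} | [forall x, (x \notin A) ==> (f x == ord0)]].

Definition upd f v b : {ffun T -> 'I_M.+1} :=
  [ffun x => if x == v then b else f x].

Lemma suppP A f : reflect (forall x, x \notin A -> f x = ord0) (f \in supp A).
Proof.
rewrite inE; apply: (iffP forallP) => h x; first by move/(implyP (h x))/eqP.
by apply/implyP => /h ->.
Qed.

Lemma suppT : supp setT = setT.
Proof. by apply/setP => f; rewrite in_setT; apply/suppP => x; rewrite in_setT. Qed.

Lemma updE f v b : upd f v b v = b. Proof. by rewrite ffunE eqxx. Qed.

Lemma updN f v b x : x != v -> upd f v b x = f x.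
Proof. by rewrite ffunE => /negbTE ->. Qed.

(** A function supported on [v |: A] amounts to a pair: the function reset to [ord0] at [v], which
    is supported on [A], and the value at [v]. *)
Lemma card_supp_setU1 v A (P : pred {ffun T -> 'I_M.+1}) : v \notin A ->
  #|[set f in supp (v |: A) | P f]| =
  \sum_(g in supp A) #|[set b | P (upd g v b)]|.
Proof.
move=> vA; under [RHS]eq_bigr do rewrite -sum1dep_card.
rewrite pair_big_dep -sum1dep_card /=.
pose h (p : {ffun T -> 'I_M.+1} * 'I_M.+1) := upd p.1 v p.2.
rewrite (reindex_onto h (fun f => (upd f v ord0, f v))) /=; last first.
  by move=> f _; apply/ffunP => x; rewrite !ffunE; case: eqP => // ->.
apply: eq_bigl => -[g b]; rewrite /h /= updE xpair_eqE eqxx andbT andbAC.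
congr (_ && _); apply/idP/idP.
  case/andP => /suppP hs /eqP hg; apply/suppP => x xA.
  rewrite -hg ffunE; case: eqP => // /eqP xv.
  by apply: hs; rewrite !inE negb_or xv.
move/suppP => hg; apply/andP; split.
  apply/suppP => x; rewrite !inE negb_or => /andP[xv xA].
  by rewrite updN // hg.
by apply/eqP/ffunP => x; rewrite !ffunE; case: eqP => // ->; rewrite hg.
Qed.

End Supported.

(** * Walks in complete graphs *)

Lemma card_neq M (c : 'I_M.+1) : #|[set b | b != c]| = M.
Proof.
have := cardsC1 c; rewrite card_ord /=; apply: etrans.
by apply: eq_card => b; rewrite !inE.
Qed.

(* (walks M i).1 and (walks M i).2 count the i-step walks in the complete graph
   on M.+1 vertices from a given vertex to itself, resp. to another given
   vertex; for M = 0 the second component is junk. *)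
Fixpoint walks (M i : nat) : nat * nat :=
  if i is j.+1 then
    let: (p, q) := walks M j in (M * q, p + M.-1 * q)
  else (1, 0).

(** The boolean lets an equality test between colors select the count, so that both cases share one
    formula. *)
Definition walk M i (same : bool) :=
  if same then (walks M i).1 else (walks M i).2.

Lemma walkS_same M i : walk M i.+1 true = M * walk M i false.
Proof. by rewrite /walk /=; case: (walks M i). Qed.

Lemma walkS_diff M i : walk M i.+1 false = walk M i true + M.-1 * walk M i false.
Proof. by rewrite /walk /=; case: (walks M i). Qed.


(** By the recursion, the difference between the two counts starts at 1 and changes sign at each
    step, so it equals (-1)^i. With [M.+1] the complete graph has at least two vertices, so both
    counts are meaningful. *)
Lemma walk_even M k : walk M.+1 k.*2 true = (walk M.+1 k.*2 false).+1
  /\ walk M.+1 k.*2.+1 false = (walk M.+1 k.*2.+1 true).+1.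
Proof.
elim: k => [|k [IH1 IH2]]; first by rewrite /walk /=; lia.
by rewrite doubleS !(walkS_same, walkS_diff) /= in IH1 IH2 *; lia.
Qed.

(** Summing over all endpoints counts every i-step walk from a fixed vertex, and each step has
    [M.+1] choices. *)
Lemma walk_total M i : walk M.+1 i true + M.+1 * walk M.+1 i false = M.+1 ^ i.
Proof.
by elim: i => [|i IH]; rewrite ?muln0 ?addn0 // walkS_same walkS_diff expnS -IH /=; nia.
Qed.

(** A walk reaches [b0] from any vertex [b] other than [b0]; this is the recursion for [walks],
    sorted by the penultimate vertex. *)
Lemma sum_walk M i (a0 b0 : 'I_M.+1) :
  \sum_(b | b != b0) walk M i (b == a0) = walk M i.+1 (b0 == a0).
Proof.
case: eqVneq => [<-|ne].
  rewrite walkS_same; under eq_bigr => b /negbTE -> do [].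
  rewrite sum_nat_const; congr (_ * _).
  by have := card_neq b0; rewrite cardsE.
rewrite walkS_diff (bigD1 a0) 1?eq_sym //= eqxx; congr (_ + _).
under eq_bigr => b /andP[_ /negbTE ->] do [].
rewrite sum_nat_const; congr (_ * _).
have := cardC (pred2 a0 b0); rewrite card_ord card2 (eq_sym a0) ne => h.
rewrite (@eq_card _ _ [predC pred2 a0 b0]) => [|b]; last first.
  by rewrite !inE negb_or andbC.
by move/(congr1 (subn^~ 2)): h; rewrite addKn subSS subn1.
Qed.

(** * Colorings twisted by bijections on paths, cycles and one-vertex extensions *)

Section Counting.
Variables (T : finType) (e : rel T) (M : nat).
Variable pi : T -> T -> 'I_M.+1 -> 'I_M.+1.
Hypothesis e_sym : symmetric e.
Hypothesis e_irr : irreflexive e.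
Hypothesis piK : forall x y, e x y -> cancel (pi x y) (pi y x).
Implicit Types (A : {set T}) (f g : {ffun T -> 'I_M.+1}).

Definition ok f : rel T := fun x y => f y != pi x y (f x).

Lemma ok_sym f x y : e x y -> ok f x y = ok f y x.
Proof.
move=> exy; have eyx : e y x by rewrite e_sym.
by rewrite /ok; congr (~~ _); apply/eqP/eqP => ->; rewrite piK.
Qed.

Lemma ok_upd f v b x y : x != v -> y != v -> ok (upd f v b) x y = ok f x y.
Proof. by move=> xv yv; rewrite /ok !updN. Qed.

Fixpoint holonomy x (p : seq T) a :=
  if p is y :: p' then holonomy y p' (pi x y a) else a.

Lemma holonomy_rcons x p y a :
  holonomy x (rcons p y) a = pi (last x p) y (holonomy x p a).
Proof. by elim: p x a => [|z p IH] x a /=. Qed.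

(** Only consecutive vertices constrain each other here; the edge closing the path to a cycle is
    imposed later. *)
Definition path_colorings v p a :=
  [set f in supp M [set x in v :: p] | (f v == a) && path (ok f) v p].

Lemma path_ok_upd f v p y b : y \notin v :: p ->
  path (ok (upd f y b)) v p = path (ok f) v p.
Proof.
elim: p v => //= z p IH v; rewrite !inE !negb_or => /and3P[yv yz yp].
by rewrite ok_upd 1?eq_sym // IH // inE negb_or yz.
Qed.

Lemma set_rcons (v : T) p y :
  [set x in v :: rcons p y] = y |: [set x in v :: p].
Proof. by apply/setP => x; rewrite !inE mem_rcons inE orbCA. Qed.

(** Taking the count by last color as a hypothesis makes this one step serve twice: in the induction
    along the path, and when the path is closed up. *)
Lemma card_path_colorings_neq v p a n h b0 :
  (forall b, #|[set f in path_colorings v p a | f (last v p) == b]| =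
    walk M n (b == h)) ->
  #|[set f in path_colorings v p a | f (last v p) != b0]| = walk M n.+1 (b0 == h).
Proof.
move=> last_count; rewrite -sum_walk -sum1_card.
rewrite (partition_big (fun f : {ffun T -> 'I_M.+1} => f (last v p))
   (fun c => c != b0)) /=; last by move=> f; rewrite !inE => /andP[].
apply: eq_bigr => c cb; rewrite -last_count -sum1_card; apply: eq_bigl => f.
by rewrite [RHS]inE inE; case: (f (last v p) =P c) => [->|]; rewrite ?andbF ?cb ?andbT.
Qed.

(** Transporting all colors back to [v] turns the condition on each edge into inequality of
    consecutive colors, so a coloring becomes a walk in the complete graph. The induction adds the
    last vertex. *)
Lemma card_path_colorings_last v p a b :
  path e v p -> uniq (v :: p) ->
  #|[set f in path_colorings v p a | f (last v p) == b]| =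
  walk M (size p) (b == holonomy v p a).
Proof.
elim/last_ind: p b => [|p y IH] b.
  move=> _ _ /=; case: (eqVneq b a) => [->|ne] /=.
    rewrite -[RHS](cards1 [ffun x => if x == v then a else ord0]).
    apply: eq_card => f; rewrite !inE andbT; apply/idP/idP.
      case/andP => /andP[/forallP h /eqP fa _]; apply/eqP/ffunP => x.
      rewrite ffunE; case: eqP => [-> //|/eqP xv].
      by move: (h x); rewrite !inE xv /= => /eqP.
    move/eqP ->; rewrite !ffunE !eqxx !andbT; apply/forallP => x.
    by rewrite !inE ffunE; case: eqP => //=; rewrite eqxx.
  apply/eqP; rewrite cards_eq0; apply/eqP/setP => f; rewrite !inE.
  by case: (eqVneq (f v) a) => [->|]; rewrite ?andbF ?andFb //= eq_sym (negbTE ne) andbF.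
rewrite rcons_path size_rcons -rcons_cons rcons_uniq => /andP[pe ely] /andP[yp up].
have eyl : e y (last v p) by rewrite e_sym.
have vy : v != y by move: yp; rewrite inE negb_or eq_sym => /andP[].
have ly : last v p != y by apply: contraNneq yp => <-; apply: mem_last.
(* The only color of the previous vertex that is incompatible with color [b] at [y]. *)
pose b0 := pi y (last v p) b.
rewrite holonomy_rcons.
have -> : (b == pi (last v p) y (holonomy v p a)) = (b0 == holonomy v p a).
  by rewrite /b0; apply/eqP/eqP => [->|<-]; rewrite piK.
rewrite -[LHS](_ : #|[set f in supp M (y |: [set x in v :: p]) |
  ((f v == a) && path (ok f) v (rcons p y)) && (f y == b)]| = _); last first.
  by apply: eq_card => f; rewrite /path_colorings set_rcons last_rcons !in_set !andbA.
rewrite card_supp_setU1 ?inE //.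
transitivity (#|[set f in path_colorings v p a | f (last v p) != b0]|).
  rewrite -sum1_card big_mkcond [RHS]big_mkcond /=.
  apply: eq_bigr => g _; rewrite !inE.
  case: ifP => // gs; rewrite /=.
  (* [C] depends on [g] alone; when it holds, [b] is the only color allowed at [y]. *)
  set C := _ && _ && _.
  transitivity (#|[set c | C && (c == b)]|).
    apply: eq_card => c; rewrite !inE rcons_path path_ok_upd // /ok updE !updN //.
    case: (c =P b) => [->|]; rewrite ?andbF //= !andbT /C -!andbA; do 2!congr (_ && _).
    rewrite /b0; congr (~~ _); apply/eqP/eqP => [->|->]; by rewrite piK.
  case: C => /=; last by apply: eq_card0 => c; rewrite !inE.
  by rewrite -(cards1 b); apply: eq_card => c; rewrite !inE.
by apply: card_path_colorings_neq => c; apply: IH.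
Qed.

(** The vertex [y] may lie on the path: with [y = v] and [b = a] the extra condition is that of the
    closing edge of a cycle. *)
Lemma card_path_colorings_close v p y a b :
  path e v (rcons p y) -> uniq (v :: p) ->
  #|[set f in path_colorings v p a | b != pi (last v p) y (f (last v p))]| =
  walk M (size p).+1 (b == holonomy v (rcons p y) a).
Proof.
rewrite rcons_path => /andP[pe ely] up.
have eyl : e y (last v p) by rewrite e_sym.
have piE c d : (d == pi (last v p) y c) = (c == pi y (last v p) d).
  by apply/eqP/eqP => ->; rewrite piK.
rewrite holonomy_rcons piE eq_sym -(@card_path_colorings_neq v p a).
  by apply: eq_card => f; rewrite !in_set piE.
by move=> c; apply: card_path_colorings_last.
Qed.

Definition colorings A :=
  [set f in supp M A | [forall x in A, forall y in A, e x y ==> ok f x y]].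

Lemma coloringsP A f : reflect
  (f \in supp M A /\ {in A &, forall x y, e x y -> ok f x y}) (f \in colorings A).
Proof.
rewrite [f \in colorings A]in_set; apply: (iffP andP) => -[fA h]; split => //.
  by move=> x y xA yA; apply/implyP; move/forall_inP/(_ x xA)/forall_inP: h; apply.
by apply/forall_inP => x xA; apply/forall_inP => y yA; apply/implyP/h.
Qed.

(** Without chords, the constraints inside the vertex set of [c] are exactly those along the cycle.
    Sorting by the color [a] of [v] then reduces to closed paths. *)
Lemma card_colorings_cycle v p (c := v :: p) :
  path.cycle e c -> uniq c ->
  {in c &, forall x y, e x y -> y = next c x \/ x = next c y} ->
  #|colorings [set x in c]| =
  \sum_a walk M (size c) (a == holonomy v (rcons p v) a).
Proof.
move=> ec uc chord; rewrite -sum1_card.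
rewrite (partition_big (fun f : {ffun T -> 'I_M.+1} => f v) xpredT) //=.
apply: eq_bigr => a _; rewrite -card_path_colorings_close // -sum1_card.
apply: eq_bigl => f; rewrite [in RHS]inE [in RHS]inE -!andbA.
have -> : (f \in colorings [set x in c]) = (f \in supp M [set x in c]) && path.cycle (ok f) c.
  apply/coloringsP/andP => -[fs h]; split => //.
    apply: cycle_from_next => // x xc.
    by apply: h; rewrite ?in_set ?mem_next //; apply: next_cycle ec xc.
  move=> x y; rewrite !in_set => xc yc exy.
  case: (chord x y xc yc exy) => [->|xE]; first exact: next_cycle.
  by rewrite ok_sym // xE; apply: next_cycle.
rewrite /c /= rcons_path -!andbA; congr (_ && _); rewrite {2}/ok.
by case: (f v =P a) => [->|]; rewrite ?andbF ?andbT.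
Qed.

Lemma card_colorings_setU1 A u v :
  v \notin A -> u \in A -> e u v -> {in A, forall w, e w v -> w = u} ->
  #|colorings (v |: A)| = #|colorings A| * M.
Proof.
move=> vA uA euv uniq_u; rewrite card_supp_setU1 // -sum_nat_const.
rewrite [RHS](eq_bigl (fun f => (f \in supp M A) &&
  [forall x in A, forall y in A, e x y ==> ok f x y])); last by move=> f; rewrite in_set.
rewrite big_mkcondr /=; apply: eq_bigr => g gA.
have ne x : x \in A -> x != v by move=> xA; apply: contraNneq vA => <-.
(* If [g] colors [A] properly, only the color [pi u v (g u)] is forbidden at [v]; otherwise no
   extension of [g] is a coloring. *)
case: ifP => hg.
  apply: etrans (card_neq (pi u v (g u))); apply: eq_card => b; rewrite !in_set.
  apply/idP/idP => [|hb].
    move/forall_inP/(_ u); rewrite !inE uA orbT => /(_ isT)/forall_inP/(_ v).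
    by rewrite !inE eqxx euv => /(_ isT); rewrite /ok updE updN // ne.
  apply/forall_inP => x /setU1P xA; apply/forall_inP => y /setU1P yA; apply/implyP.
  wlog yv : x y xA yA / y != v => [hw|] exy.
    case: (eqVneq y v) => yv; last exact: hw.
    case: (eqVneq x v) => [xv|xv]; first by rewrite yv xv e_irr in exy.
    by rewrite ok_sym //; apply: hw => //; rewrite e_sym.
  case: yA => [yE|yA]; first by rewrite yE eqxx in yv.
  case: xA => [xE|xA].
    have yu : y = u by apply: uniq_u; rewrite // -xE e_sym.
    by rewrite ok_sym // yu xE /ok updE updN // ne.
  rewrite ok_upd ?ne //.
  by move/forall_inP/(_ x xA)/forall_inP/(_ y yA)/implyP: hg; apply.
apply: eq_card0 => b; rewrite in_set; apply: contraFF hg => /forall_inP h.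
apply/forall_inP => x xA; apply/forall_inP => y yA.
have /h/forall_inP/(_ y) : x \in v |: A by rewrite !inE xA orbT.
by rewrite ok_upd ?ne // => -> //; rewrite !inE yA orbT.
Qed.

End Counting.

(** * The structure of unicyclic graphs *)

Section Unicyclic.
Variables (T : finType) (e : rel T) (c : seq T).
Hypothesis e_sym : symmetric e.
Hypothesis e_irr : irreflexive e.
Hypothesis e_conn : gconnected e.
Hypothesis c_cycle : is_gcycle e c.
Hypothesis c_unique : forall c', is_gcycle e c' -> cycle_edges c' = cycle_edges c.
Implicit Types A : {set T}.

(** Each vertex of [c'] lies on an edge of [c'], which is also an edge of [c]. *)
Lemma gcycle_sub c' : is_gcycle e c' -> {subset c' <= c}.
Proof.
move=> gc' x xc'; have := c_unique gc'; case/and3P: c_cycle => _ _ _ E.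
have : [set x; next c' x] \in cycle_edges c by rewrite -E; apply: imset_f.
case/imsetP => w wc /setP/(_ x); rewrite !inE eqxx => /esym/orP[] /eqP -> //.
by rewrite mem_next.
Qed.

(* A chord of c would close up an arc of c to a cycle having the chord as an edge. *)
Lemma chordless : {in c &, forall x y, e x y -> y = next c x \/ x = next c y}.
Proof.
move=> x y xc yc exy; case/and3P: c_cycle => ec uc _.
have xy : x != y by apply: contraTneq exy => ->; rewrite e_irr.
have [i s cE] := rot_to xc.
have ys : y \in s.
  by move: yc; rewrite -(mem_rot i) cE inE eq_sym (negbTE xy).
have uxs : uniq (x :: s) by rewrite -cE rot_uniq.
have exs : path.cycle e (x :: s) by rewrite -cE rot_cycle.
case/splitPr: ys cE uxs exs => s1 s2 cE uxs exs.
case: s1 => [|z s1] in cE uxs exs.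
  by left; rewrite -(next_rot i uc) cE /= eqxx.
(* The arc of [c] from [x] to [y]; it has an inner vertex [z], so the chord closes it to a cycle of
   length at least 3. *)
pose c' := x :: rcons (z :: s1) y.
have gc' : is_gcycle e c'.
  apply/and3P; split; last by rewrite /c' /= size_rcons.
    rewrite /c' /= rcons_path last_rcons (e_sym y) exy andbT.
    move: exs; rewrite /= rcons_path -cat_rcons cat_path.
    by case/and3P => -> /andP[-> _] _.
  by move: uxs; rewrite -cat_rcons -cat_cons cat_uniq => /andP[].
have nyx : next c' y = x.
  case/and3P: gc' => _ uc' _; have := cycle_next uc'.
  by rewrite -[X in path.cycle _ X]/(x :: rcons (z :: s1) y) [path.cycle _ _]rcons_path last_rcons => /andP[_ /eqP].
have : [set y; next c' y] \in cycle_edges c.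
  by rewrite -(c_unique gc'); apply: imset_f; rewrite /c' !inE mem_rcons !inE eqxx !orbT.
rewrite nyx => /imsetP[w wc E].
have : x \in [set w; next c w] by rewrite -E !inE eqxx orbT.
have : y \in [set w; next c w] by rewrite -E !inE eqxx.
move=> /set2P[] yE /set2P[] xE; [|by right; rewrite xE yE|by left; rewrite xE yE|].
  by rewrite xE yE eqxx in xy.
by rewrite xE yE eqxx in xy.
Qed.

Definition inner A : rel T := [rel x y | [&& x \in A, y \in A & e x y]].

Definition connected_in A := {in A &, forall x y, connect (inner A) x y}.

Lemma inner_path_sub A x p : path (inner A) x p -> {subset p <= A}.
Proof.
elim: p x => //= y p IH x /andP[/and3P[_ yA _] /IH h] z.
by rewrite inE => /predU1P[->|/h].
Qed.

(** Two neighbors of [v] in [A] would be joined by a path inside [A], which closes up through [v] to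
    a cycle not contained in [c]. *)
Lemma unique_neighbor A u v w : {subset c <= A} -> connected_in A ->
  v \notin A -> u \in A -> w \in A -> e u v -> e w v -> w = u.
Proof.
move=> cA connA vA uA wA euv ewv; apply/eqP; apply/idPn => wu.
have /connectP[p0 pp0 E0] := connA u w uA wA.
(* The path is made simple, so that adding [v] gives a cycle; [w != u] makes it nonempty, hence the
   cycle has length at least 3. *)
move: E0 wu; case/shortenP: pp0 => p pp up _ wE wu.
suff vc : v \in c by rewrite cA in vA.
apply: (@gcycle_sub (v :: u :: p)); last by rewrite inE eqxx.
have pA := inner_path_sub pp.
apply/and3P; split.
- rewrite /= rcons_path -wE ewv andbT e_sym euv /=.
  by apply: sub_path pp => x y /and3P[].
- rewrite cons_uniq up andbT inE negb_or; apply/andP; split.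
    by apply: contraNneq vA => ->.
  by apply: contra vA => /pA.
- by case: (p) wE wu => [|//] /= ->; rewrite eqxx.
Qed.

(** Otherwise [A] would be closed under adjacency, and connectedness would force it to be
    everything. *)
Lemma boundary_edge A x : x \in A -> A != setT ->
  exists u v, [/\ u \in A, v \notin A & e u v].
Proof.
move=> xA; rewrite -subTset => /subsetPn[y _ yA].
suff : [exists u in A, exists v, (v \notin A) && e u v].
  by case/exists_inP => u uA /existsP[v /andP[vA euv]]; exists u, v.
apply: contraNT yA => /exists_inPn h.
have A_closed : closed e (mem A).
  apply: intro_closed; first exact: sym_connect_sym.
  move=> u v euv uA; apply/idPn => vA.
  by have := h u uA => /existsPn/(_ v); rewrite vA euv.
by rewrite -(closed_connect A_closed (forallP (forallP e_conn x) y)).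
Qed.

Lemma connected_in_cycle : connected_in [set x in c].
Proof.
move=> x y; rewrite !in_set => xc yc; apply: connect_cycle xc yc.
case/and3P: c_cycle => ec _ _; apply: (@sub_in_cycle _ (mem c)) ec; last exact/allP.
by move=> u w uc wc euw; rewrite /inner /= !in_set; apply/and3P.
Qed.

Lemma connected_in_setU1 A u v :
  connected_in A -> u \in A -> e u v -> connected_in (v |: A).
Proof.
move=> connA uA euv.
have inner_sym : connect_sym (inner (v |: A)).
  by apply: sym_connect_sym => x y; rewrite /inner /= e_sym andbCA.
have to_u x : x \in v |: A -> connect (inner (v |: A)) u x.
  case/setU1P => [->|xA]; first by apply: connect1; rewrite /inner /= euv setU11 !in_setU uA orbT.
  apply: connect_sub (connA u x uA xA) => a b /and3P[aA bA eab].
  by apply: connect1; rewrite /inner /= !in_setU aA bA eab !orbT.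
by move=> x y /to_u ux /to_u; apply: connect_trans; rewrite inner_sym.
Qed.

Variables (M : nat) (pi : T -> T -> 'I_M.+1 -> 'I_M.+1).
Hypothesis piK : forall x y, e x y -> cancel (pi x y) (pi y x).

(** Induction on the number of vertices outside [A]. Connectedness of [A] is carried along because
    it gives each added vertex a unique neighbor. *)
Lemma card_colorings_grow A : {subset c <= A} -> connected_in A ->
  #|colorings e pi setT| = #|colorings e pi A| * M ^ #|~: A|.
Proof.
move nE : #|~: A| => n; elim: n A nE => [|n IH] A nE cA connA.
  by rewrite muln1 -[A]setCK (cards0_eq nE) setC0.
have [x xc] : exists x, x \in c.
  by case/and3P: c_cycle; case: (c) => // x s _ _ _; exists x; rewrite inE eqxx.
have AT : A != setT by apply: contra_eq_neq nE => ->; rewrite setCT cards0.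
have [u [v [uA vA euv]]] := boundary_edge (cA x xc) AT.
rewrite (IH (v |: A)).
- rewrite (card_colorings_setU1 e_sym e_irr piK vA uA euv) ?expnS ?mulnA // => w wA ewv.
  exact: unique_neighbor cA connA vA uA wA euv ewv.
- have := cardsC (v |: A); have := cardsC A; rewrite cardsU1 vA nE; lia.
- by move=> z /cA zA; rewrite !inE zA orbT.
- exact: connected_in_setU1 uA euv.
Qed.

(** The vertices off the cycle contribute a factor independent of [pi], so the count depends on [pi]
    only through the number of colors fixed by the holonomy. *)
Lemma card_colorings_unicyclic v p : c = v :: p ->
  #|colorings e pi setT| =
  (\sum_a walk M (size c) (a == holonomy pi v (rcons p v) a)) * M ^ (#|T| - size c).
Proof.
move=> cE; have [ec uc _] := and3P c_cycle.
rewrite (@card_colorings_grow [set x in c]); first last.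
- exact: connected_in_cycle.
- by move=> x; rewrite in_set.
congr (_ * M ^ _); last first.
  by rewrite cardsCs setCK cardsE (card_uniqP uc).
move: ec uc chordless; rewrite cE => ec uc chord.
by rewrite (card_colorings_cycle e_sym piK ec uc chord).
Qed.

End Unicyclic.

(* A partial matching of 'I_m with 'I_m extends to a bijection: correct it on one
   point at a time by composing with a transposition. *)
Lemma matching_extension (C : finType) (R : rel C) :
  (forall a b b', R a b -> R a b' -> b = b') ->
  (forall a a' b, R a b -> R a' b -> a = a') ->
  exists2 s : C -> C, injective s & forall a b, R a b -> s a = b.
Proof.
move=> Rfun Rinj.
suff [s s_inj sR] : exists2 s : C -> C, injective s &
    forall a b, a \in enum C -> R a b -> s a = b.
  by exists s => // a b; apply: sR; rewrite mem_enum.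
elim: (enum C) => [|x l [s s_inj sR]]; first by exists id.
have [xl|xl] := boolP (x \in l).
  by exists s => // a b; rewrite inE => /predU1P[->|]; apply: sR.
case: (pickP (R x)) => [y Rxy|noR]; last first.
  by exists s => // a b; rewrite inE => /predU1P[->|]; [rewrite noR | apply: sR].
(* The transposition sends [x] to [y]. It moves no value matched earlier: such a value differs from
   [s x] since [s] is injective, and from [y] since [R] is. *)
exists (tperm (s x) y \o s); first exact: inj_comp perm_inj s_inj.
move=> a b /=; rewrite inE => /predU1P[-> Rxb|al Rab].
  by rewrite tpermL; apply: Rfun Rxy Rxb.
have ax : a != x by apply: contraNneq xl => <-.
rewrite (sR a b al Rab) tpermD //.
  by apply: contraNneq ax => sxb; apply/eqP/s_inj; rewrite sxb; apply: sR.
by apply: contraNneq ax => yb; apply/eqP; apply: Rinj Rab _; rewrite -yb.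
Qed.

(** * Covers, their colorings, and covers given by bijections *)

Section Covers.
Variables (T : finType) (e : rel T) (m : nat).
Hypothesis e_sym : symmetric e.
Hypothesis e_irr : irreflexive e.
Local Notation cover := {set (T * 'I_m) * (T * 'I_m)}.
Implicit Types (H : cover) (f : {ffun T -> 'I_m}) (S : {set T * 'I_m}).

Lemma is_coverP H : reflect
  [/\ forall x y, hadj H x y = hadj H y x,
      forall x, ~~ hadj H x x,
      forall u a b, a != b -> hadj H (u, a) (u, b),
      forall u v a b, u != v -> hadj H (u, a) (v, b) -> e u v
    & forall u v a b b', u != v ->
        hadj H (u, a) (v, b) -> hadj H (u, a) (v, b') -> b = b']
  (is_cover e H).
Proof.
apply: (iffP and5P) => -[h1 h2 h3 h4 h5]; split.
- by move=> x y; apply/eqP; move/forallP/(_ x)/forallP: h1.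
- exact/forallP.
- by move=> u a b ab; move/forallP/(_ (u, a))/forallP/(_ (u, b)): h3; rewrite /= eqxx ab.
- move=> u v a b uv; move/forallP/(_ (u, a))/forallP/(_ (v, b)): h4.
  by rewrite /= uv => /implyP.
- move=> u v a b b' uv hb hb'.
  move/forallP/(_ (u, a))/forallP/(_ v)/implyP: h5 => /=.
  by rewrite eq_sym => /(_ uv)/card_le1_eqP; apply; rewrite inE.
- by apply/forallP => x; apply/forallP => y; rewrite h1.
- exact/forallP.
- apply/forallP => -[u a]; apply/forallP => -[v b] /=; apply/implyP => /andP[/eqP <-].
  exact: h3.
- apply/forallP => -[u a]; apply/forallP => -[v b] /=; apply/implyP => /andP[].
  exact: h4.
- apply/forallP => -[u a]; apply/forallP => v /=; apply/implyP => vu.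
  apply/card_le1_eqP => b b'; rewrite !inE => hb hb'; apply: (h5 u v a) hb' hb.
  by rewrite eq_sym.
Qed.

Definition cover_colorings H :=
  [set f : {ffun T -> 'I_m} | [forall x, forall y, ~~ hadj H (x, f x) (y, f y)]].

Definition graph_of f : {set T * 'I_m} := [set p | p.2 == f p.1].

Lemma graph_ofE f : graph_of f = [set (x, f x) | x in T].
Proof.
apply/setP => -[x a]; rewrite inE /=; apply/eqP/imsetP => [->|[y _ [-> ->]] //].
by exists x.
Qed.

(** An independent set meets each clique over a vertex at most once. Having [#|T|] elements, it
    meets each exactly once and is therefore the graph of a function. *)
Lemma PDP_coverE H : is_cover e H -> PDP_cover H = #|cover_colorings H|.
Proof.
case/is_coverP => _ _ Hclique _ _.
have graph_inj : injective graph_of.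
  move=> f g fg; apply/ffunP => x; apply/eqP.
  by move/setP/(_ (x, f x)): fg; rewrite !inE /= eqxx.
rewrite /PDP_cover -(card_imset _ graph_inj); apply: eq_card => S; rewrite inE.
apply/andP/imsetP => [[indep /eqP card_S]|[f]].
  have fst_inj : {in S &, injective fst}.
    move=> [x a] [y b] xaS ybS /= xy; rewrite -{y}xy in ybS *.
    congr (_, _); apply/eqP; apply/idPn => /(Hclique x) ab.
    by move/forall_inP/(_ _ xaS)/forall_inP/(_ _ ybS): indep; rewrite ab.
  have fst_onto x : exists a, (x, a) \in S.
    have : x \in [set p.1 | p in S].
      suff -> : [set p.1 | p in S] = setT by [].
      by apply/eqP; rewrite eqEcard subsetT cardsT card_in_imset // card_S leqnn.
    by case/imsetP => -[y a] yaS /= ->; exists a.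
  have [g gS] := fin_all_exists fst_onto.
  have SE : S = graph_of (finfun g).
    apply/setP => -[x a]; rewrite inE /= ffunE; apply/idP/eqP => [xaS|-> //].
    by have [] := fst_inj _ _ xaS (gS x) erefl.
  exists (finfun g) => //; rewrite inE; apply/forallP => x; apply/forallP => y.
  rewrite !ffunE.
  by move/forall_inP/(_ _ (gS x))/forall_inP/(_ _ (gS y)): indep.
rewrite inE => /forallP h ->; split; last first.
  by rewrite graph_ofE card_imset // => x y [].
apply/forall_inP => -[x a]; rewrite inE => /eqP /= ->.
apply/forall_inP => -[y b]; rewrite inE => /eqP /= ->.
by move/forallP: (h x).
Qed.

Lemma PDP_eq N H : is_cover e H -> #|cover_colorings H| = N ->
  (forall H', is_cover e H' -> N <= #|cover_colorings H'|) -> PDP e m = N.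
Proof.
move=> cH HN minN; rewrite /PDP; case: ex_minnP => n /existsP[H' /andP[cH' /eqP nE]] n_min.
apply/eqP; rewrite eqn_leq -{2}nE PDP_coverE // minN // andbT.
by apply: n_min; apply/existsP; exists H; rewrite cH PDP_coverE // HN eqxx.
Qed.

Section FromPermutations.
Variable pi : T -> T -> 'I_m -> 'I_m.
Hypothesis piK : forall x y, e x y -> cancel (pi x y) (pi y x).

Definition perm_cover : cover :=
  [set p | (p.1.1 == p.2.1) && (p.1.2 != p.2.2)
        || e p.1.1 p.2.1 && (p.2.2 == pi p.1.1 p.2.1 p.1.2)].

Lemma perm_coverE u v a b : hadj perm_cover (u, a) (v, b) =
  (u == v) && (a != b) || e u v && (b == pi u v a).
Proof. by rewrite /hadj inE. Qed.

Lemma perm_cover_ok : is_cover e perm_cover.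
Proof.
apply/is_coverP; split.
- move=> [u a] [v b]; rewrite !perm_coverE eq_sym (eq_sym a) (e_sym u); congr (_ || _).
  case evu: (e v u) => //=; have euv : e u v by rewrite e_sym.
  by apply/eqP/eqP => ->; rewrite piK.
- by move=> [u a]; rewrite perm_coverE !eqxx e_irr.
- by move=> u a b ab; rewrite perm_coverE eqxx ab.
- by move=> u v a b /negbTE uv; rewrite perm_coverE uv => /andP[].
- move=> u v a b b' /negbTE uv; rewrite !perm_coverE uv.
  by move=> /andP[_ /eqP ->] /andP[_ /eqP ->].
Qed.

Lemma perm_cover_colorings : cover_colorings perm_cover =
  [set f : {ffun T -> 'I_m} | [forall x, forall y, e x y ==> (f y != pi x y (f x))]].
Proof.
apply/setP => f; rewrite !inE; apply: eq_forallb => x; apply: eq_forallb => y.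
rewrite perm_coverE negb_or; case: (eqVneq x y) => [->|xy] /=.
  by rewrite e_irr eqxx.
by rewrite negb_and implybE.
Qed.

End FromPermutations.

(** Completing every matching to a bijection keeps all edges of [H], so no new coloring can
    appear. *)
Lemma cover_in_perm_cover H : is_cover e H ->
  exists2 pi : T -> T -> 'I_m -> 'I_m,
    forall x y, e x y -> cancel (pi x y) (pi y x)
  & cover_colorings (perm_cover pi) \subset cover_colorings H.
Proof.
case/is_coverP => Hsym Hirr Hclique Hedge Hmatch.
have ext_ex (p : T * T) : exists s : 'I_m -> 'I_m, injective s /\
    (p.1 != p.2 -> forall a b, hadj H (p.1, a) (p.2, b) -> s a = b).
  case: p => x y /=; case: (eqVneq x y) => [_|xy]; first by exists id; split => // a b.
  have [a b b'|a a' b|s s_inj sR] := @matching_extension _ (fun a b => hadj H (x, a) (y, b)).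
  - exact: Hmatch.
  - by rewrite 2!(Hsym (x, _)); apply: Hmatch; rewrite eq_sym.
  - by exists s.
have [s sP] := fin_all_exists ext_ex.
(* The bijections chosen for [(x, y)] and [(y, x)] need not be mutually inverse. One is kept,
   according to the rank of the endpoints, and the other direction gets its inverse. *)
pose pi x y := if enum_rank x < enum_rank y then s (x, y)
  else invF (proj1 (sP (y, x))).
have rank_neq x y : x != y -> enum_rank x < enum_rank y = ~~ (enum_rank y < enum_rank x).
  by move=> xy; rewrite -leqNgt [RHS]leq_eqVlt val_eqE (inj_eq enum_rank_inj) (negbTE xy).
exists pi => [x y exy|].
  have xy : x != y by apply: contraTneq exy => ->; rewrite e_irr.
  rewrite /pi (rank_neq _ x y) //; case: ltnP => _ /= a; first by rewrite f_invF.
  by rewrite invF_f.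
apply/subsetP => f; rewrite perm_cover_colorings !inE => /forallP h.
apply/forallP => x; apply/forallP => y; apply/negP => hxy.
have xy : x != y by apply: contraTneq hxy => ->; apply: Hirr.
have := forallP (h x) y; rewrite (Hedge _ _ _ _ xy hxy) /= => /negP; apply; apply/eqP.
rewrite /pi; case: ifP => _; first by rewrite (proj2 (sP (x, y)) xy _ _ hxy).
apply: (proj1 (sP (y, x))); rewrite f_invF.
by apply: (proj2 (sP (y, x))) => /=; rewrite 1?eq_sym // Hsym.
Qed.

End Covers.

Lemma cover_colorings_perm_cover T e M pi :
  irreflexive e -> cover_colorings (@perm_cover T e M.+1 pi) = colorings e pi setT.
Proof.
move=> e_irr; rewrite perm_cover_colorings //; apply/setP => f.
rewrite in_set; apply/forallP/coloringsP => [h|[_ h] x].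
  split; first by rewrite suppT in_setT.
  by move=> x y _ _; apply/implyP; apply: (forallP (h x)).
by apply/forallP => y; apply/implyP; apply: h.
Qed.

Lemma holonomy_id (T : finType) M (pi : T -> T -> 'I_M.+1 -> 'I_M.+1) x p a :
  path (fun x y => pi x y a == a) x p -> holonomy pi x p a = a.
Proof. by elim: p x => //= y p IH x /andP[/eqP ->]; apply: IH. Qed.

(** * The cover twisted by a cyclic shift on one edge *)

Section Twist.
Variables (T : finType) (M : nat) (v w : T).

Definition twist (x y : T) : 'I_M.+2 -> 'I_M.+2 :=
  if (x == v) && (y == w) then @ordS _
  else if (x == w) && (y == v) then @ord_pred _ else id.

Lemma twistK x y : v != w -> cancel (twist x y) (twist y x).
Proof.
move=> vw a; rewrite /twist.
case: (eqVneq x v) (eqVneq y w) (eqVneq x w) (eqVneq y v) => [xv|_] [yw|_] [xw|_] [yv|_] //=;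
  rewrite ?ordSK ?ord_predK //; by case/eqP: vw; congruence.
Qed.

Lemma ordS_neq (a : 'I_M.+2) : ordS a != a.
Proof.
rewrite -val_eqE /=; have := ltn_ord a; rewrite leq_eqVlt => /predU1P[[->]|lt].
  by rewrite modnn.
by rewrite modn_small // neq_ltn ltnSn orbT.
Qed.

(* Along a cycle of length at least 3, only the first edge is twisted. *)
Lemma holonomy_twist p a : uniq [:: v, w & p] -> p != [::] ->
  holonomy twist v (rcons (w :: p) v) a = ordS a.
Proof.
rewrite [uniq _]/= inE negb_or => /and3P[/andP[vw vp] wp _] p0.
have twist_id x y b : x != v -> y != v -> twist x y b = b.
  by move=> /negbTE xv /negbTE yv; rewrite /twist xv yv andbF.
rewrite rcons_cons /= holonomy_rcons holonomy_id.
  have lw : last w p != w.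
    by case: p p0 wp {vp} => //= z p _; apply: contraNneq => <-; apply: mem_last.
  have lv : last w p != v.
    apply: contraNneq vp => lE; have := mem_last w p.
    by rewrite lE inE (negbTE vw).
  by rewrite /twist (negbTE lw) (negbTE lv) !eqxx.
rewrite {2 3}/twist !eqxx /=; move: (ordS a) => b.
have wv : w != v by rewrite eq_sym.
elim: p w wv vp {vw wp p0} => //= z p IH x xv; rewrite inE negb_or eq_sym => /andP[zv vp].
by rewrite twist_id ?eqxx //= IH.
Qed.

End Twist.

Lemma chrom_id (T : finType) (e : rel T) m : irreflexive e ->
  #|cover_colorings (perm_cover e (fun _ _ => @id 'I_m))| = chrom e m.
Proof.
move=> e_irr; rewrite perm_cover_colorings //; apply: eq_card => f; rewrite !inE.
by apply: eq_forallb => x; apply: eq_forallb => y; rewrite eq_sym.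
Qed.

(** * Covers attaining the minimum *)

Section MinimalCovers.
Variables (T : finType) (e : rel T) (c : seq T).
Hypothesis e_sym : symmetric e.
Hypothesis e_irr : irreflexive e.
Hypothesis e_conn : gconnected e.
Hypothesis c_cycle : is_gcycle e c.
Hypothesis c_unique : forall c', is_gcycle e c' -> cycle_edges c' = cycle_edges c.

Lemma card_perm_cover_unicyclic M (pi : T -> T -> 'I_M.+1 -> 'I_M.+1) v p :
  (forall x y, e x y -> cancel (pi x y) (pi y x)) -> c = v :: p ->
  #|cover_colorings (perm_cover e pi)| =
  (\sum_a walk M (size c) (a == holonomy pi v (rcons p v) a)) * M ^ (#|T| - size c).
Proof.
move=> piK; rewrite cover_colorings_perm_cover //.
exact: card_colorings_unicyclic.
Qed.

(** Here [b] tells which colors, fixed ([true]) or moved ([false]) by the holonomy, give fewer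
    walks. Each of the [M.+1] starting colors contributes at least that many. *)
Lemma cover_colorings_ge M b (H : {set (T * 'I_M.+1) * (T * 'I_M.+1)}) :
  (forall a h : 'I_M.+1, walk M (size c) b <= walk M (size c) (a == h)) ->
  is_cover e H ->
  M.+1 * walk M (size c) b * M ^ (#|T| - size c) <= #|cover_colorings H|.
Proof.
move=> walk_min /(cover_in_perm_cover e_irr)[pi piK /subset_leq_card]; apply: leq_trans.
have [v [p cE]] : exists v p, c = v :: p.
  by case/and3P: c_cycle; case: (c) => // v p _ _ _; exists v, p.
rewrite (card_perm_cover_unicyclic piK cE) leq_mul2r; apply/orP; right.
by rewrite -[in leqLHS](card_ord M.+1) -sum_nat_const; apply: leq_sum.
Qed.

Lemma PDP_odd_cycle m : odd (size c) -> PDP e m = chrom e m.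
Proof.
move=> odd_c; have [v [p cE]] : exists v p, c = v :: p.
  by case/and3P: c_cycle; case: (c) => // v p _ _ _; exists v, p.
have id_ok : is_cover e (perm_cover e (fun _ _ => @id 'I_m)) by apply: perm_cover_ok.
apply: (PDP_eq id_ok); first exact: chrom_id.
case: m id_ok => [|M] id_ok H cH.
  (* Without colors there is no function on [T], which contains [v], so the bound is 0. *)
  by rewrite /chrom (@eq_card0 _ _) // => f; case: (f v).
rewrite -chrom_id // (card_perm_cover_unicyclic _ cE) //.
apply: leq_trans (@cover_colorings_ge M true H _ cH).
  rewrite leq_mul2r; apply/orP; right.
  rewrite (eq_bigr (fun=> walk M (size c) true)); last first.
    move=> a _; rewrite [_ == _](_ : _ = true) //; apply/eqP/esym.
    by move: (rcons p v) => q; elim: q v {cE} => //= y q IH v; apply: IH.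
  by rewrite sum_nat_const card_ord.
move=> a h; case: eqP => // ah.
(* With a single color, [a] and [h] cannot differ; from two colors on, [walk_even] applies. *)
case: M a h ah {id_ok H cH} => [|M] a h ah; first by rewrite !ord1 in ah.
have [_] := walk_even M (size c)./2.
by rewrite -[_.*2.+1]/(true + _) -odd_c odd_double_half => ->.
Qed.

Lemma PDP_even_cycle m : ~~ odd (size c) -> 2 <= m ->
  PDP e m = (m - 1) ^ #|T| - (m - 1) ^ (#|T| - size c).
Proof.
case: m => [|[|M]] // even_c _; rewrite subn1 /=.
have [v [w [p [cE p0]]]] : exists v w p, c = [:: v, w & p] /\ p != [::].
  case/and3P: c_cycle; case: (c) => [|v [|w [|z p]]] // _ _ _.
  by exists v, w, (z :: p).
have [ec uc _] := and3P c_cycle.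
have vw : v != w by move: uc; rewrite cE /= inE negb_or => /andP[/andP[]].
have twK x y : e x y -> cancel (@twist T M v w x y) (twist v w y x).
  by move=> _; apply: twistK.
have [walkE _] := walk_even M (size c)./2.
have cK : (size c)./2.*2 = size c by rewrite even_halfK.
rewrite cK in walkE.
(* Let l be the cycle length and d the count for distinct endpoints. The closed walks number d + 1,
   so (M+1)^l = (d + 1) + (M+1) d and (M+2) d = (M+1)^l - 1. *)
have -> : M.+1 ^ #|T| - M.+1 ^ (#|T| - size c) =
  M.+2 * walk M.+1 (size c) false * M.+1 ^ (#|T| - size c).
  have le_c : size c <= #|T| by rewrite -(card_uniqP uc) max_card.
  rewrite -{1}(subnKC le_c) expnD -walk_total walkE.
  by rewrite -[X in _ - X]mul1n -mulnBl; congr (_ * _); lia.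
have tw_ok := perm_cover_ok e_sym e_irr twK.
apply: (PDP_eq tw_ok) => [|H cH].
  rewrite (card_perm_cover_unicyclic twK cE); congr (_ * _).
  rewrite (eq_bigr (fun=> walk M.+1 (size c) false)).
    by rewrite sum_nat_const card_ord.
  (* The shift has no fixed color, so every starting color contributes the smaller count. *)
  move=> a _; rewrite holonomy_twist -?cE // eq_sym.
  by rewrite (negbTE (ordS_neq a)).
by apply: cover_colorings_ge cH => a h; case: (a == h); rewrite // walkE.
Qed.

End MinimalCovers.

Theorem mainTheorem5 (T : finType) (e : rel T)
  (e_sym : symmetric e) (e_irr : irreflexive e) (k : nat) :
  (unicyclic_with_cycle_len e (2 * k + 1) ->
     forall m : nat, PDP e m = chrom e m) /\
  (unicyclic_with_cycle_len e (2 * k + 2) ->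
     forall m : nat, 2 <= m ->
       PDP e m = (m - 1) ^ #|T| - (m - 1) ^ (#|T| - (2 * k + 2))).
Proof.
split=> -[conn [c [gc sc uniq_c]]] m => [|m2]; rewrite -?sc.
  by apply: (PDP_odd_cycle e_sym e_irr conn gc uniq_c); rewrite sc oddD oddM.
by apply: (PDP_even_cycle e_sym e_irr conn gc uniq_c); rewrite // sc oddD oddM.
Qed.
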